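(* (i) For every finite simple connected planar graph $G$ with at least two vertices, $D(G) < \frac{5}{2}\, r(G)$. (ii) There is an infinite family of finite simple connected planar graphs $G$ with $D(G) = \frac{5}{2} r(G) - O(1)$; that is, there exist a constant $C$ and infinitely many pairwise non-isomorphic such graphs $G$ satisfying $D(G) \ge \frac{5}{2} r(G) - C$.
   Context: For a finite connected graph $G=(V,E)$ the diameter is $D(G)=\max_{u,v\in V}\mathrm{dist}(u,v)$, where $\mathrm{dist}(u,v)$ is the minimum number of edges on a $u$-$v$ path. The inverse degree is $r(G)=\sum_{v\in V} 1/d(v)$, where $d(v)$ is the degree of $v$. *)

(* Defs.v *)
From HB Require Import structures.
From mathcomp Require Import all_boot all_order all_algebra.
From mathcomp Require Import all_classical all_reals all_analysis.

Set Implicit Arguments.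
Unset Strict Implicit.
Unset Printing Implicit Defensive.

Import Order.TTheory GRing.Theory Num.Theory.
Import numFieldNormedType.Exports.
Local Open Scope classical_set_scope.
Local Open Scope ring_scope.

Record sgraph := SGraph {
  vertex :> finType;
  edge : rel vertex;
  edge_sym : symmetric edge;
  edge_irr : irreflexive edge }.

Definition isomorphic (G H : sgraph) : Prop :=
  exists2 f : G -> H, bijective f & forall x y, edge (f x) (f y) = edge x y.

Definition connected_graph (G : sgraph) : Prop :=
  (0 < #|G|)%N /\ forall x y : G, connect (@edge G) x y.

Definition deg (G : sgraph) (v : G) : nat := #|[set w : G | edge v w]%SET|.

Definition is_upath (G : sgraph) (u v : G) (p : seq G) : bool :=
  [&& path (@edge G) u p, last u p == v & uniq (u :: p)].

(* A path has fewer than #|G| edges, so bounding its length by #|G| loses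
   nothing; the default value #|G| is only taken when no u-v path exists. *)
Definition dist (G : sgraph) (u v : G) : nat :=
  \big[minn/#|G|]_(k < #|G| | [exists p : k.-tuple G, is_upath u v p]) k.

Definition diameter (G : sgraph) : nat :=
  (\max_(u : G) \max_(v : G) dist u v)%N.

Definition inverse_degree (R : realType) (G : sgraph) : R :=
  \sum_(v : G) (deg v)%:R^-1.

(* Planarity is topological. The edge {x, y} is drawn as the simple arc
   [arc x y], parametrised from [pt x] to [pt y]; [arc y x] is the same arc
   traversed backwards. Values of [arc] on non-adjacent pairs, or outside the
   unit interval, are irrelevant. *)
Record plane_drawing (R : realType) (G : sgraph)
    (pt : G -> R * R) (arc : G -> G -> R -> R * R) : Prop := PlaneDrawing {
  drawing_pt_inj : injective pt;
  drawing_continuous : forall x y, edge x y ->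
    {within `[0, 1], continuous (arc x y)};
  drawing_arc_inj : forall x y, edge x y ->
    {in `[0, 1] &, injective (arc x y)};
  drawing_source : forall x y, edge x y -> arc x y 0 = pt x;
  drawing_target : forall x y, edge x y -> arc x y 1 = pt y;
  drawing_reverse : forall x y, edge x y ->
    {in `[0, 1], forall t, arc y x t = arc x y (1 - t)};
  drawing_avoid_pt : forall x y z, edge x y ->
    {in `]0, 1[, forall t, arc x y t <> pt z};
  drawing_disjoint : forall x y z w, edge x y -> edge z w ->
    [set x; y]%SET <> [set z; w]%SET ->
    {in `]0, 1[ &, forall s t, arc x y s <> arc z w t} }.

Definition planar (R : realType) (G : sgraph) : Prop :=
  exists (pt : G -> R * R) (arc : G -> G -> R -> R * R),
    plane_drawing pt arc.

(* Main.v *)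
Require Import Defs.
From HB Require Import structures.
From mathcomp Require Import all_boot all_order all_algebra.
From mathcomp Require Import all_classical all_reals all_analysis.
From mathcomp Require Import zify ring lra.

Set Implicit Arguments.
Unset Strict Implicit.
Unset Printing Implicit Defensive.

Import Order.TTheory GRing.Theory Num.Theory.
Local Open Scope ring_scope.

(* Upper bound. Arcs of a drawing can be replaced by fine chains of points, and
   for two chains a, b that stay far apart the parity of the number of times b
   crosses a half-line issued from the ends of a is tied to the parity for the
   ends of b. Summing over the pairs of disjoint edges of K5 gives van Kampen's
   obstruction: in any drawing of K5 some two disjoint edges meet. Since only
   disjoint edges matter, edges may be routed through branch sets, so a planar
   graph has no K5 minor, and by Mader's theorem every minor with n >= 3 vertices
   has at most 3n - 6 edges. Split the distance layers of an end of a diametral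
   path at the layers with at most two vertices. Applying Mader's bound to each
   slab, in which the bottom layer is made complete by contracting everything
   below it, yields 2|E| + 8D < 9|V| + 3k, where k is the number of vertices of
   degree at most 2. The theorem follows from 20/d >= 9 - d + 3[d <= 2].

   Sharpness. In the strong product of a path with K2 (copies of K4 glued along
   edges) all inner degrees are 5, so each layer adds 2/5 to the inverse degree.
   Placing layer i at the points -i and i of a line gives a two-page book
   embedding, drawn with parabolic arcs. *)

(** * Crossing parities of point chains in the plane, and van Kampen's obstruction for K5 *)

Section Winding.
Variables (R : realType) (e : R).
Implicit Types u v p q x y : R * R.

(** Sup-norm scales: when both points of a difference move to close ones, the difference moves by
    less than [2e], well below the separation [4e] imposed by [far]. *)
Definition close p q := (`|p.1 - q.1| < e) && (`|p.2 - q.2| < e).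

Definition far p q := (4%:R * e <= `|p.1 - q.1|) || (4%:R * e <= `|p.2 - q.2|).

(** A half-open half-plane: of [u] and [- u], with [u] nonzero, exactly one belongs to it, so points
    on the axis also get a definite side. *)
Definition upper u := (0 < u.2) || ((u.2 == 0) && (0 < u.1)).

(** Crossing of the positive first half-axis. Testing the sign at [u] alone is enough: a short step
    far from the origin that changes side stays near the axis, where the first coordinate keeps its
    sign. *)
Definition cross u v := (upper u (+) upper v) && (0 < u.1).

Fixpoint wind p x (s : seq (R * R)) : bool :=
  if s is y :: s' then cross (x - p) (y - p) (+) wind p y s' else false.

Lemma upperN u : u != 0 -> upper (- u) = ~~ upper u.
Proof.
case: u => a b; rewrite -pair_eqE /= /upper /=.
by rewrite oppr_gt0 oppr_eq0; case: (ltgtP b 0) => //=; case: (ltgtP a 0) => //=; lra.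
Qed.

Lemma far_neq0 p q : 0 < e -> far p q -> p - q != 0.
Proof.
move=> e0; apply: contraTneq => /eqP; rewrite subr_eq0 => /eqP ->.
by rewrite /far !subrr normr0; lra.
Qed.

Definition close2 u v := (`|u.1 - v.1| < 2%:R * e) && (`|u.2 - v.2| < 2%:R * e).

Lemma upper_flip u v : close2 u v -> upper u != upper v -> `|u.2| < 2%:R * e.
Proof.
case/andP=> _; rewrite /upper ltr_norml => /andP[h1 h2].
case: (ltgtP u.2 0) => h3; case: (ltgtP v.2 0) => h4 //=; rewrite ltr_norml; lra.
Qed.

(** Crossings cancel around a small quadrilateral away from the origin. If [upper] varies on it, all
    four first coordinates have the same sign, so [cross] is either the coboundary of [upper] or
    zero. *)
Lemma cross4 z1 z2 z3 z4 :
  (forall z z', z \in [:: z1; z2; z3; z4] -> z' \in [:: z1; z2; z3; z4] -> close2 z z') ->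
  (forall z, z \in [:: z1; z2; z3; z4] -> far z 0) ->
  cross z1 z2 (+) cross z3 z4 = cross z1 z3 (+) cross z2 z4.
Proof.
move=> cl fr.
have sgn z z' : z \in [:: z1; z2; z3; z4] -> z' \in [:: z1; z2; z3; z4] ->
    upper z != upper z' -> forall y, y \in [:: z1; z2; z3; z4] -> (0 < y.1) = (0 < z.1).
  move=> hz hz' /(upper_flip (cl _ _ hz hz')) bz y hy.
  have /andP[] := cl _ _ hy hz; have := fr _ hy; have := fr _ hz.
  move: bz; rewrite /far /= !subr0 !ltr_norml => /andP[? ?].
  move=> /orP[]; rewrite ler_normr => /orP[] ?; last 2 [lra|lra];
  move=> /orP[]; rewrite ler_normr => /orP[] ? /andP[? ?] /andP[? ?];
  by apply/idP/idP; lra.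
have [i1 i2 i3 i4] : [/\ z1 \in [:: z1; z2; z3; z4], z2 \in [:: z1; z2; z3; z4],
    z3 \in [:: z1; z2; z3; z4] & z4 \in [:: z1; z2; z3; z4]].
  by rewrite !inE !eqxx !orbT.
rewrite /cross.
have [e12|/(sgn _ _ i1 i2) s] := eqVneq (upper z1) (upper z2); last first.
  rewrite ?(s _ i2) ?(s _ i3) ?(s _ i4); case: (0 < z1.1); rewrite ?andbF // !andbT.
  by case: (upper z1) (upper z2) (upper z3) (upper z4) => [] [] [] [].
have [e13|/(sgn _ _ i1 i3) s] := eqVneq (upper z1) (upper z3); last first.
  rewrite ?(s _ i2) ?(s _ i3) ?(s _ i4); case: (0 < z1.1); rewrite ?andbF // !andbT.
  by case: (upper z1) (upper z2) (upper z3) (upper z4) => [] [] [] [].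
have [e14|/(sgn _ _ i1 i4) s] := eqVneq (upper z1) (upper z4); last first.
  rewrite ?(s _ i2) ?(s _ i3) ?(s _ i4); case: (0 < z1.1); rewrite ?andbF // !andbT.
  by case: (upper z1) (upper z2) (upper z3) (upper z4) => [] [] [] [].
by rewrite -e12 -e13 -e14 addbb.
Qed.

Lemma cross_square p p' q q' : close p p' -> close q q' ->
  far q p -> far q' p -> far q p' -> far q' p' ->
  cross (q - p) (q' - p) (+) cross (q - p') (q' - p') =
  cross (q - p) (q - p') (+) cross (q' - p) (q' - p').
Proof.
move=> /andP[] + + /andP[]; rewrite !ltr_norml => /andP[? ?] /andP[? ?] /andP[? ?] /andP[? ?].
move=> f1 f2 f3 f4; apply: cross4 => [z z'|z].
  rewrite !inE => /or4P[] /eqP-> /or4P[] /eqP->; rewrite /close2 /= !ltr_norml;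
  apply/andP; split; apply/andP; split; lra.
by rewrite !inE => /or4P[] /eqP->; rewrite /far /= !subr0.
Qed.

(** Adding up [cross_square] along the chain cancels the inner terms modulo 2 and leaves those of
    its two ends. *)
Lemma wind_shift p p' x s : close p p' -> path close x s ->
  (forall y, y \in x :: s -> far y p && far y p') ->
  wind p x s (+) wind p' x s = cross (x - p) (x - p') (+) cross (last x s - p) (last x s - p').
Proof.
move=> cp; elim: s x => [|y s IH] x /=; first by rewrite !addbb.
move=> /andP[cxy ps] fr.
have /andP[fx fx'] := fr x (mem_head _ _).
have /andP[fy fy'] : far y p && far y p' by apply: fr; rewrite !inE eqxx orbT.
have /(IH y ps): forall z, z \in y :: s -> far z p && far z p'.
  by move=> z hz; apply: fr; rewrite inE hz orbT.
rewrite addbACA (cross_square cp cxy fx fy fx' fy') => ->.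
by rewrite addbA -(addbA (cross (x - p) _)) addbb addbF.
Qed.

(** A step that changes side crosses exactly one of the two half-axes, and negation exchanges
    them. *)
Lemma crossN u v : 0 < e -> close2 u v -> far u 0 -> far v 0 ->
  cross u v (+) cross (- u) (- v) = upper u (+) upper v.
Proof.
move=> e0 cuv fu fv.
have u0 : u != 0 by have := far_neq0 e0 fu; rewrite subr0.
have v0 : v != 0 by have := far_neq0 e0 fv; rewrite subr0.
rewrite /cross !upperN // addNb addbN negbK.
have [->|ne] := eqVneq (upper u) (upper v); first by rewrite !addbb.
have : upper u (+) upper v by case: (upper u) (upper v) ne => [] [].
move=> ->; rewrite /= oppr_gt0.
have := upper_flip cuv ne; move: fu; rewrite /far /= !subr0 ltr_norml.
move=> /orP[]; rewrite ler_normr => /orP[] ? /andP[? ?].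
- case: (ltgtP u.1 0) => // ?; exfalso. lra.
- case: (ltgtP u.1 0) => // ?; exfalso. lra.
- exfalso; lra.
- exfalso; lra.
Qed.

(** Reversed differences count crossings of the opposite half-line; [crossN] converts them, and the
    values of [upper] telescope. *)
Lemma windN q x s : 0 < e -> path close x s -> (forall y, y \in x :: s -> far y q) ->
  \big[addb/false]_(i < size s) cross (q - nth 0 (x :: s) i) (q - nth 0 s i) =
  wind q x s (+) upper (x - q) (+) upper (last x s - q).
Proof.
move=> e0; elim: s x => [|y s IH] x /=; first by rewrite big_ord0 addbb.
move=> /andP[cxy ps] fr; rewrite big_ord_recl /= IH //; last first.
  by move=> z hz; apply: fr; rewrite inE hz orbT.
have := @crossN (x - q) (y - q) e0; rewrite !opprB.
have fx : far (x - q) 0 by have := fr _ (mem_head _ _); rewrite /far /= !subr0.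
have fy : far (y - q) 0.
  have : far y q by apply: fr; rewrite !inE eqxx orbT.
  by rewrite /far /= !subr0.
have cl : close2 (x - q) (y - q).
  case/andP: cxy; rewrite /close2 /= !ltr_norml => /andP[? ?] /andP[? ?].
  by apply/andP; split; apply/andP; split; lra.
move=> /(_ cl fx fy).
move: (cross _ _) (cross _ _) (wind _ _ _) (upper _) (upper _) (upper _).
by do 6! case.
Qed.

(** When the base point runs along the first chain, the winding of the second changes only by
    crossings seen from [y] and [last y t]. By [windN] these are the windings of the first chain
    about those ends, up to orientation terms. *)
Lemma wind_exchange x s y t : 0 < e -> path close x s -> path close y t ->
  (forall p q, p \in x :: s -> q \in y :: t -> far p q) ->
  ~~ odd (wind x y t + wind (last x s) y t + (wind y x s + wind (last y t) x s) +
   (upper (x - y) + upper (x - last y t) +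
    (upper (last x s - y) + upper (last x s - last y t)))).
Proof.
move=> e0 ps pt fr; have farC p q : far p q = far q p.
  by rewrite /far !(distrC p.1) !(distrC p.2).
have {}fr' p q : p \in x :: s -> q \in y :: t -> far q p by rewrite farC; exact: fr.
suff : wind x y t (+) wind (last x s) y t =
   (wind y x s (+) upper (x - y) (+) upper (last x s - y)) (+)
   (wind (last y t) x s (+) upper (x - last y t) (+) upper (last x s - last y t)).
  rewrite !oddD !oddb; move: (wind _ _ _) (wind _ _ _) (wind _ _ _) (wind _ _ _).
  move: (upper _) (upper _) (upper _) (upper _).
  by do 8! case.
rewrite -!windN //; try by move=> z hz; apply: fr; rewrite ?mem_last ?mem_head.
rewrite -big_split /=; elim: s x ps fr fr' => [|x' s IH] x /=.
  by move=> *; rewrite addbb big_ord0.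
move=> /andP[cx ps] fr fr'; rewrite big_ord_recl /=.
rewrite -(IH x') //; first last.
- by move=> p q hp; apply: fr'; rewrite inE hp orbT.
- by move=> p q hp; apply: fr; rewrite inE hp orbT.
rewrite addbA; have /= <- := wind_shift cx pt.
  by rewrite -addbA -(addbA _ (wind x' _ _)) (addbA (wind x' _ _)) addbb addFb.
by move=> z hz; rewrite !fr' // !inE eqxx ?orbT.
Qed.

End Winding.

(* Summed over the fifteen pairs of disjoint edges of K5, every winding term
   occurs twice, while the orientations of the differences of vertices leave
   one unit for each of the five 4-subsets. *)
Lemma K5_far (R : realType) (e : R) (c : nat -> R * R)
    (g : nat -> nat -> seq (R * R)) : 0 < e ->
  (forall i j, i < j < 5 -> c i != c j)%N ->
  (forall i j, i < j < 5 -> path (close e) (c i) (g i j) /\ last (c i) (g i j) = c j)%N ->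
  ~ (forall i j k l, i < j < 5 -> k < l < 5 -> uniq [:: i; j; k; l] ->
     {in c i :: g i j & c k :: g k l, forall p q, far e p q})%N.
Proof.
move=> e0 cI gP fr.
pose w i j k := nat_of_bool (wind (c i) (c j) (g j k)).
pose h i j := nat_of_bool (upper (c i - c j)).
have H i j k l : (i < j < 5)%N -> (k < l < 5)%N -> uniq [:: i; j; k; l] ->
  ~~ odd (w i k l + w j k l + (w k i j + w l i j) + (h i k + h i l + (h j k + h j l))).
  move=> ij kl u; have [p1 l1] := gP _ _ ij; have [p2 l2] := gP _ _ kl.
  have := wind_exchange e0 p1 p2 (fr _ _ _ _ ij kl u).
  by rewrite l1 l2.
have hN i j : (i < j < 5)%N -> (h i j + h j i = 1)%N.
  by move=> ij; rewrite /h -(opprB (c i) (c j)) upperN ?subr_eq0 ?cI //; case: (upper _).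
(* Each even sum is written as a double, which turns the fifteen parities into linear equations over
   the naturals. *)
have E i j k l ij kl u : exists n : nat, _ = n.*2 :=
  ex_intro _ _ (esym (even_halfK (H i j k l ij kl u))).
clearbody w h; clear H e0 cI gP fr.
have [k0123] := E 0 1 2 3 isT isT isT.
have [k0124] := E 0 1 2 4 isT isT isT.
have [k0134] := E 0 1 3 4 isT isT isT.
have [k0213] := E 0 2 1 3 isT isT isT.
have [k0214] := E 0 2 1 4 isT isT isT.
have [k0234] := E 0 2 3 4 isT isT isT.
have [k0312] := E 0 3 1 2 isT isT isT.
have [k0314] := E 0 3 1 4 isT isT isT.
have [k0324] := E 0 3 2 4 isT isT isT.
have [k0412] := E 0 4 1 2 isT isT isT.
have [k0413] := E 0 4 1 3 isT isT isT.
have [k0423] := E 0 4 2 3 isT isT isT.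
have [k1234] := E 1 2 3 4 isT isT isT.
have [k1324] := E 1 3 2 4 isT isT isT.
have [k1423] := E 1 4 2 3 isT isT isT.
have := hN 0 1 isT.
have := hN 0 2 isT.
have := hN 0 3 isT.
have := hN 0 4 isT.
have := hN 1 2 isT.
have := hN 1 3 isT.
have := hN 1 4 isT.
have := hN 2 3 isT.
have := hN 2 4 isT.
have := hN 3 4 isT.
lia.
Qed.

(** * Fine chains in connected sets, and separation of compact sets *)

Section Chains.
Import numFieldNormedType.Exports.
Local Open Scope classical_set_scope.
Variable R : realType.

Lemma ball_close (e : R) (p q : R * R) : close e p q <-> ball p e q.
Proof. by rewrite /close; split => [/andP[]|[]]; [split|move=> h1 h2; apply/andP]. Qed.

Lemma closeC (e : R) : symmetric (close e).
Proof. by move=> p q; rewrite /close !(distrC p.1) !(distrC p.2). Qed.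

(** The points reachable from [p] by chains inside [K] form a nonempty, relatively open and
    relatively closed subset of [K]. *)
Lemma connected_chain (K : set (R * R)) (e : R) p q : 0 < e -> connected K -> K p -> K q ->
  exists s, [/\ path (close e) p s, last p s = q & {in p :: s, forall x, K x}].
Proof.
move=> e0 cK Kp Kq.
pose B := [set q | exists s,
  [/\ path (close e) p s, last p s = q & {in p :: s, forall x, K x}]].
have BK x : B x -> K x.
  by move=> [s [_ <- h]]; apply: h; exact: mem_last.
have Bext x y : B x -> K y -> close e x y -> B y.
  move=> [s [ps ls sK]] Ky xy; exists (rcons s y); split.
  - by rewrite rcons_path ps ls.
  - by rewrite last_rcons.
  - by move=> z; rewrite -rcons_cons mem_rcons inE => /orP[/eqP->//|/sK].
have b0 (x : R * R) (d : R) : 0 < d -> open_nbhs x (ball x d)^°.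
  by move=> d0; split; [exact: open_interior|exact: nbhsx_ballx].
suff : B = K by move=> BE; have : B q by rewrite BE.
apply: cK.
- by exists p, [::]; split => //= x; rewrite inE => /eqP->.
- exists (\bigcup_(x in B) (ball x e)^°); first by apply: bigcup_open => x _; exact: open_interior.
  apply/seteqP; split=> x.
    by move=> Bx; split; [exact: BK|exists x => //; exact: nbhsx_ballx].
  move=> [Kx [y By]] /interior_subset /ball_close; exact: Bext.
- exists (~` \bigcup_(x in K `\` B) (ball x e)^°).
    by apply: open_closedC; apply: bigcup_open => x _; exact: open_interior.
  apply/seteqP; split=> x.
    move=> Bx; split; first exact: BK.
    move=> [y [Ky nBy]] /interior_subset /ball_close xy; apply: nBy.
    by apply: Bext Bx Ky _; rewrite closeC.
  move=> [Kx nx]; apply: contrapT => nBx; apply: nx; exists x => //.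
  exact: nbhsx_ballx.
Qed.

(** For nonempty sets the distance attains a positive minimum; [d] is a quarter of it because [far]
    asks for [4e]. Admitting every [e <= d] lets finitely many pairs share one scale. *)
Lemma compact_far (K L : set (R * R)) : compact K -> compact L -> K `&` L = set0 ->
  exists2 d : R, 0 < d & forall p q e, e <= d -> K p -> L q -> far e p q.
Proof.
move=> cK cL KL.
have [K0|/set0P K0] := eqVneq K set0; first by exists 1 => // p q e _; rewrite K0.
have [L0|/set0P L0] := eqVneq L set0; first by exists 1 => // p q e _ _; rewrite L0.
pose f (z : (R * R) * (R * R)) : R := `|z.1 - z.2|.
have [|||[c c'] cKL cmin] := @compact_EVT_min _ R f (K `*` L).
- by case: K0 L0 => a Ka [b Lb]; exists (a, b).
- exact: compact_setX.
- apply: continuous_subspaceT => z; rewrite /f.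
  apply: (@continuous_comp _ _ _ (fun z : (R * R) * (R * R) => z.1 - z.2)
    (fun x => `|x|)); last exact: norm_continuous.
  by apply: continuousB; [exact: cvg_fst|exact: cvg_snd].
move: cKL; rewrite inE => -[/= Kc Lc'].
have d0 : 0 < f (c, c').
  rewrite normr_gt0 subr_eq0; apply/eqP => /= cc.
  have : (K `&` L) c by split; rewrite // cc.
  by rewrite KL.
exists (f (c, c') / 4%:R) => [|p q e ed Kp Lq]; first by rewrite divr_gt0.
have : f (c, c') <= f (p, q) by apply: cmin; rewrite inE.
rewrite {2}/f /= prod_normE /= le_max /far; move: ed; rewrite ler_pdivlMr // mulrC => ed.
by move=> /orP[] h; apply/orP; [left|right]; apply: le_trans ed h.
Qed.
End Chains.

(** * Branch sets, and the exclusion of K5 models by a plane drawing *)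

Definition connected_set (T : finType) (e : rel T) (A : {set T}) : Prop :=
  {in A &, forall x y, connect [rel u v | [&& u \in A, v \in A & e u v]] x y}.

Definition K5_model (T : finType) (e : rel T) (B : nat -> {set T}) : Prop :=
  [/\ forall i, (i < 5)%N -> B i != finset.set0 /\ connected_set e (B i),
      forall i j, (i < j < 5)%N -> [disjoint B i & B j] &
      forall i j, (i < j < 5)%N -> exists x y, [/\ x \in B i, y \in B j & e x y]].

Lemma connected_setU (T : finType) (e : rel T) (A B : {set T}) x y :
  symmetric e -> connected_set e A -> connected_set e B ->
  x \in A -> y \in B -> e x y -> connected_set e (A :|: B).
Proof.
move=> se cA cB xA yB exy.
pose r := [rel u v | [&& u \in A :|: B, v \in A :|: B & e u v]].
have rs : connect_sym r.
  by apply: sym_connect_sym => u v; rewrite /= se andbCA.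
have sub (C : {set T}) : C \subset A :|: B -> connected_set e C ->
    {in C &, forall u v, connect r u v}.
  move=> /fintype.subsetP CAB cC u v uC vC.
  apply: connect_sub (cC u v uC vC) => a b /= /and3P[aC bC eab].
  by apply: connect1; rewrite /= !CAB.
have cx u : u \in A :|: B -> connect r x u.
  rewrite finset.in_setU => /orP[uA|uB]; first exact: (sub A (finset.subsetUl _ _)).
  apply: connect_trans (connect1 _) (sub B (finset.subsetUr _ _) cB y u yB uB).
  by rewrite /= !inE xA yB exy orbT.
by move=> u v uAB vAB; apply: connect_trans (cx v vAB); rewrite rs; exact: cx.
Qed.

Section PlanarK5.
Import numFieldNormedType.Exports.
Local Open Scope classical_set_scope.
Variables (R : realType) (G : sgraph) (pt : G -> R * R) (arc : G -> G -> R -> R * R).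
Hypothesis dr : plane_drawing pt arc.

(** A non-adjacent pair stands for the point of its first vertex, so the diagonal pairs supply the
    vertices and [trace A] is the drawing of the subgraph induced by [A]. *)
Definition piece (z : G * G) : set (R * R) :=
  if edge z.1 z.2 then arc z.1 z.2 @` `[0, 1] else [set pt z.1].

Definition trace (A : {set G}) : set (R * R) :=
  \bigcup_(z in [set z | (z.1 \in A) && (z.2 \in A)]) piece z.

Lemma piece_compact z : compact (piece z).
Proof.
rewrite /piece; case: ifP => ez; last exact: compact_set1.
by apply: continuous_compact; [exact: (drawing_continuous dr)|exact: segment_compact].
Qed.

Lemma piece_connected z : connected (piece z).
Proof.
rewrite /piece; case: ifP => ez; last exact: connected1.
by apply: connected_continuous_connected; [exact: segment_connected|exact: (drawing_continuous dr)].
Qed.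

Lemma trace_compact A : compact (trace A).
Proof.
rewrite /trace (bigcup_pred (fun z : G * G => (z.1 \in A) && (z.2 \in A)) piece).
by apply: bigsetU_compact => z _; exact: piece_compact.
Qed.

Lemma arc_ends x y (t : R) : edge x y -> `[0, 1] t ->
  [\/ arc x y t = pt x, arc x y t = pt y | t \in `]0, 1[%R].
Proof.
move=> xy; rewrite /= !in_itv /= => /andP[t0 t1].
move: t0; rewrite le_eqVlt => /orP[/eqP<-|t0]; first by rewrite (drawing_source dr xy); constructor 1.
move: t1; rewrite le_eqVlt => /orP[/eqP->|t1]; first by rewrite (drawing_target dr xy); constructor 2.
by constructor 3; rewrite t0 t1.
Qed.

Lemma piece_disjoint (x y z w : G) : x != z -> x != w -> y != z -> y != w ->
  piece (x, y) `&` piece (z, w) = set0.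
Proof.
move=> xz xw yz yw; apply/seteqP; split => // p [] /=; rewrite /piece /=.
case: ifP => exy; case: ifP => ezw.
- move=> [s s01 <-] [t t01]; case: (arc_ends exy s01) => [->|->|si];
  case: (arc_ends ezw t01) => [->|->|ti];
   try by move/(drawing_pt_inj dr)/eqP;
     rewrite eq_sym ?(negbTE xz) ?(negbTE xw) ?(negbTE yz) ?(negbTE yw).
  + exact: (drawing_avoid_pt dr).
  + exact: (drawing_avoid_pt dr).
  + by move/esym; exact: (drawing_avoid_pt dr).
  + by move/esym; exact: (drawing_avoid_pt dr).
  + move/esym; apply: (drawing_disjoint dr) => //; move/setP/(_ x).
    by rewrite !inE eqxx (negbTE xz) (negbTE xw).
- move=> [s s01 <-] /esym; case: (arc_ends exy s01) => [->|->|si] /esym;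
   try by move/(drawing_pt_inj dr)/eqP;
     rewrite ?(negbTE xz) ?(negbTE xw) ?(negbTE yz) ?(negbTE yw).
  exact: (drawing_avoid_pt dr).
- move=> -> [s s01]; case: (arc_ends ezw s01) => [->|->|si];
   try by move/(drawing_pt_inj dr)/eqP;
     rewrite eq_sym ?(negbTE xz) ?(negbTE xw) ?(negbTE yz) ?(negbTE yw).
  exact: (drawing_avoid_pt dr).
- by move=> -> /(drawing_pt_inj dr)/eqP; rewrite (negbTE xz).
Qed.

Lemma trace_disjoint (A A' : {set G}) : [disjoint A & A']%B -> trace A `&` trace A' = set0.
Proof.
move=> dA; apply/seteqP; split => // p [[[x y] /= /andP[xA yA] px] [[z w] /= /andP[zA wA] pz]].
have ne u v : u \in A -> v \in A' -> u != v.
  by move=> uA vA; apply: contraTneq vA => <-; rewrite (disjointFr dA).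
have : (piece (x, y) `&` piece (z, w)) p by [].
by rewrite piece_disjoint ?ne.
Qed.

Lemma piece_source z : piece z (pt z.1).
Proof.
rewrite /piece; case: ifP => // ez; exists 0; first by rewrite /= in_itv /= lexx ler01.
exact: drawing_source.
Qed.

Lemma piece_target z : edge z.1 z.2 -> piece z (pt z.2).
Proof.
move=> ez; rewrite /piece ez; exists 1; first by rewrite /= in_itv /= lexx ler01.
exact: drawing_target.
Qed.

Lemma trace_chain (A : {set G}) (e : R) x y : 0 < e -> connected_set (@edge G) A ->
  x \in A -> y \in A ->
  exists s, [/\ path (close e) (pt x) s, last (pt x) s = pt y &
    {in pt x :: s, forall p, trace A p}].
Proof.
move=> e0 cA xA yA; have /connectP[s] := cA _ _ xA yA.
elim: s x xA => [|z s IH] x xA /=.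
  move=> _ ->; exists [::]; split => // p; rewrite inE => /eqP->.
  by exists (x, x); [rewrite /= xA|exact: piece_source].
move=> /andP[/and3P[_ zA exz] ps] ls.
have [t [pt1 lt1 tA]] := IH z zA ps ls.
have [u [pu lu uA]] := connected_chain e0 (@piece_connected (x, z))
  (piece_source _) (@piece_target (x, z) exz).
exists (u ++ t); split; first by rewrite cat_path pu lu.
  by rewrite last_cat lu.
move=> p; rewrite -cat_cons mem_cat => /orP[/uA pp|pp].
  by exists (x, z) => //=; rewrite xA zA.
by apply: tA; rewrite inE pp orbT.
Qed.

(** There are finitely many pairs of vertex sets, so the least of their separations is still
    positive. *)
Lemma trace_far : exists2 d : R, 0 < d & forall A A' : {set G}, [disjoint A & A']%B ->
  forall p q, trace A p -> trace A' q -> far d p q.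
Proof.
have /choice[d dP] (z : {set G} * {set G}) : exists d : R, 0 < d /\
    ([disjoint z.1 & z.2]%B -> forall p q e, e <= d ->
      trace z.1 p -> trace z.2 q -> far e p q).
  have [dz|nz] := boolP [disjoint z.1 & z.2]%B; last by exists 1.
  have [d d0 fd] := compact_far (@trace_compact z.1) (@trace_compact z.2) (trace_disjoint dz).
  by exists d.
exists (\big[Num.min/1]_z d z).
  by elim/big_ind: _ => // [x y x0 y0|z _]; [rewrite lt_min x0 y0|case: (dP z)].
move=> A A' dA p q pA qA; have [_] := dP (A, A'); apply => //.
exact: bigmin_le_cond.
Qed.

(** The edge [ij] of K5 becomes a chain in the trace of [B i :|: B j]. For disjoint index pairs
    these unions are disjoint, so the chains are far apart, which [K5_far] forbids. *)
Lemma plane_drawing_no_K5 B : ~ K5_model (@edge G) B.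
Proof.
move=> [Bc Bd Be]; have [d d0 fard] := trace_far.
have /choice[v vP] i : exists v, (i < 5)%N -> v \in B i.
  have [i5|] := boolP (i < 5)%N; last by case: (Bc 0%N isT) => /finset.set0Pn[v _] _; exists v.
  by have [/finset.set0Pn[v vi] _] := Bc i i5; exists v.
have Bd' i j : (i < 5)%N -> (j < 5)%N -> i != j -> [disjoint B i & B j]%B.
  move=> i5 j5; rewrite neq_ltn => /orP[] ij; first by apply: Bd; rewrite ij.
  by rewrite disjoint_sym; apply: Bd; rewrite ij.
have /choice[g gP] (z : nat * nat) : exists s, (z.1 < z.2 < 5)%N ->
    [/\ path (close d) (pt (v z.1)) s, last (pt (v z.1)) s = pt (v z.2) &
        {in pt (v z.1) :: s, forall p, trace (B z.1 :|: B z.2) p}].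
  case: z => i j /=; have [ij|] := boolP (i < j < 5)%N; last by exists [::].
  have [x [y [xi yj exy]]] := Be i j ij; have /andP[ij' j5] := ij.
  have i5 := ltn_trans ij' j5.
  have cA : connected_set (@edge G) (B i :|: B j).
    have [[_ ci] [_ cj]] := (Bc i i5, Bc j j5).
    by apply: connected_setU exy => //; exact: edge_sym.
  have [|| s sP] := trace_chain d0 cA (x := v i) (y := v j).
  - by rewrite finset.inE vP.
  - by rewrite finset.inE vP ?orbT.
  by exists s.
apply: (@K5_far R d (pt \o v) (fun i j => g (i, j))) => //.
- move=> i j /andP[ij j5]; apply/eqP => /(drawing_pt_inj dr) vv.
  have i5 := ltn_trans ij j5.
  have := vP j j5; rewrite -vv (disjointFr (Bd' i j i5 j5 _) (vP i i5)) //.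
  by rewrite neq_ltn ij.
- by move=> i j ij; have [] := gP (i, j) ij.
- move=> i j k l ij kl; rewrite /= !inE !negb_or !andbT.
  move=> /andP[/and3P[_ ik il] /andP[/andP[jk jl] _]].
  have [/andP[ij' j5] /andP[kl' l5]] := (ij, kl).
  have [i5 k5] := (ltn_trans ij' j5, ltn_trans kl' l5).
  move=> p q pi qk; have [_ _ /(_ p pi) pt1] := gP (i, j) ij.
  have [_ _ /(_ q qk) pt2] := gP (k, l) kl.
  apply: fard pt1 pt2; apply/pred0P => x /=; rewrite !finset.inE; apply/negbTE/negP.
  by move=> /andP[/orP[] xi /orP[] xk]; move: xk;
    rewrite (disjointFr (Bd' _ _ _ _ _) xi).
Qed.

End PlanarK5.

(** * Minors and Mader's edge bound *)

Section Mader.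
Import mathcomp.boot.fintype mathcomp.boot.finset.
Variables (T : finType) (e : rel T).
Hypothesis e_sym : symmetric e.
Implicit Types (S : {set T}) (E : rel T).

(** The vertex type stays [T] under all operations: [S] holds the surviving vertices, and the branch
    sets are constrained on [S] only. *)
Definition minor S E : Prop :=
  [/\ symmetric E, irreflexive E &
   exists B : T -> {set T},
    [/\ {in S, forall x, B x != set0 /\ connected_set e (B x)},
        {in S &, forall x y, x != y -> [disjoint B x & B y]} &
        {in S &, forall x y, E x y -> exists u v, [/\ u \in B x, v \in B y & e u v]}]].

(** [x] inherits the neighbours of [y]; [y] itself is discarded by passing to [S :\ y]. *)
Definition contract E x y : rel T :=
  [rel u v | (u != v) && [|| E u v, (u == x) && E y v | (v == x) && E u y]].

Definition remove_edge E x y : rel T :=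
  [rel u v | E u v && ([set u; v] != [set x; y])].

Lemma minor_del S E x : minor S E -> minor (S :\ x) E.
Proof.
move=> [sE iE [B [Bc Bd Be]]]; split=> //; exists B.
have sub u : u \in S :\ x -> u \in S by rewrite !inE => /andP[].
by split=> [u /sub|u v /sub + /sub|u v /sub + /sub]; [exact: Bc|exact: Bd|exact: Be].
Qed.

Lemma minor_remove_edge S E x y : minor S E -> minor S (remove_edge E x y).
Proof.
move=> [sE iE [B [Bc Bd Be]]]; split=> [u v|u|]; first by rewrite /remove_edge /= sE setUC.
  by rewrite /remove_edge /= iE.
by exists B; split => // u v uS vS /= /andP[+ _]; exact: Be.
Qed.

Lemma minor_contract S E x y : minor S E -> x \in S -> y \in S -> E x y ->
  minor (S :\ y) (contract E x y).
Proof.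
move=> [sE iE [B [Bc Bd Be]]] xS yS exy; split=> [u v|u|].
- by rewrite /contract /= (eq_sym u v) (sE u v) (sE u y) (sE v y) [in RHS](orbC (_ && _)).
- by rewrite /contract /= eqxx.
exists (fun u => if u == x then B x :|: B y else B u).
have nxy : x != y by apply: contraTneq exy => ->; rewrite iE.
have sub u : u \in S :\ y -> (u \in S) /\ (u != y) by rewrite !inE => /andP[].
split.
- move=> u /sub[uS uy]; case: ifP => ux; last exact: Bc.
  have [Bx cx] := Bc x xS; have [By cy] := Bc y yS.
  split; first by rewrite setU_eq0 negb_and Bx.
  have [a [b [ax bx eab]]] := Be _ _ xS yS exy.
  exact: connected_setU ax bx eab.
- have dU v : v \in S -> v != x -> v != y -> [disjoint B x :|: B y & B v].
    by move=> vS vx vy; rewrite -setI_eq0 setIUl setU_eq0 !setI_eq0 !Bd // eq_sym.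
  move=> u v /sub[uS uy] /sub[vS vy] uv; case: eqVneq => ux; case: eqVneq => vx.
  + by rewrite ux vx eqxx in uv.
  + exact: dU.
  + by rewrite disjoint_sym dU.
  + exact: Bd.
- move=> u v /sub[uS uy] /sub[vS vy] /= /andP[uv].
  pose B' w := if w == x then B x :|: B y else B w.
  have eB u' v' : u' \in S -> v' \in S -> E u' v' -> B u' \subset B' u -> B v' \subset B' v ->
     exists a b, [/\ a \in B' u, b \in B' v & e a b].
    move=> u'S v'S /(Be _ _ u'S v'S)[a [b [aB bB eab]]] /subsetP s1 /subsetP s2.
    by exists a, b; rewrite s1 ?s2.
  have sb w : B w \subset B' w.
    by rewrite /B'; case: eqVneq => // ->; exact: subsetUl.
  case/or3P => [euv|/andP[ux eyv]|/andP[vx euy]].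
  + exact: eB euv _ _.
  + by apply: (eB y v) => //; rewrite /B' ux subsetUr.
  + by apply: (eB u y) => //; rewrite /B' vx subsetUr.
Qed.

Lemma minor_clique S E s : minor S E -> size s = 5 -> {subset s <= S} -> pairwise E s ->
  exists B, K5_model e B.
Proof.
move=> [sE iE [B [Bc Bd Be]]] s5 sS /pairwiseP cl.
have [x0 _] : exists x, x \in s by case: s s5 {sS cl} => // x s _; exists x; rewrite mem_head.
have Es i j : (i < j < 5)%N -> E (nth x0 s i) (nth x0 s j).
  move=> /andP[ij j5]; apply: (cl x0) => //; rewrite inE s5 //.
  exact: ltn_trans j5.
have nS i : (i < 5)%N -> nth x0 s i \in S by move=> i5; rewrite sS ?mem_nth ?s5.
exists (fun i => B (nth x0 s i)); split=> [i i5|i j ij|i j ij].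
- by apply: Bc; exact: nS.
- have /andP[ij' j5] := ij; apply: Bd; [|exact: nS|].
    by apply: nS; exact: ltn_trans j5.
  by apply: contraTneq (Es _ _ ij) => ->; rewrite iE.
- have /andP[ij' j5] := ij; apply: Be; [|exact: nS|exact: Es].
  by apply: nS; exact: ltn_trans j5.
Qed.

Definition degree S E x := #|[set y in S | E x y]|.

(** For a symmetric irreflexive [E], twice the number of edges inside [S]; Mader's bound then reads
    [6n - 12]. *)
Definition degree_sum S E := (\sum_(x in S) degree S E x)%N.

Lemma eq_degree_sum S E E' : {in S &, E =2 E'} -> degree_sum S E = degree_sum S E'.
Proof.
move=> EE; apply: eq_bigr => x xS; apply: eq_card => y; rewrite !inE.
by case: (boolP (y \in S)) => //= yS; rewrite EE.
Qed.

Lemma degree_sum_del S E x : symmetric E -> irreflexive E -> x \in S ->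
  degree_sum S E = (degree_sum (S :\ x) E + (degree S E x).*2)%N.
Proof.
move=> sE iE xS; rewrite /degree_sum (big_setD1 x) //= addnC -addnn addnA; congr addn.
have degD y : degree S E y = (degree (S :\ x) E y + E x y)%N.
  rewrite /degree (cardsD1 x) addnC !inE xS sE /=; congr addn.
  by apply: eq_card => z; rewrite !inE andbA.
rewrite (eq_bigr _ (fun y _ => degD y)) big_split /=; congr addn.
have -> : degree S E x = (\sum_(y in S) E x y)%N.
  rewrite /degree -sum1_card (eq_bigl (fun y => (y \in S) && E x y)); last first.
    by move=> y; rewrite !inE.
  by rewrite big_mkcondr; apply: eq_bigr => y _; case: (E x y).
by rewrite [RHS](big_setD1 x) //= iE add0n.
Qed.

Lemma degree_lt S E x : irreflexive E -> x \in S -> (degree S E x < #|S|)%N.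
Proof.
move=> iE xS; rewrite [X in (_ < X)%N](cardsD1 x) xS ltnS; apply: subset_leq_card.
apply/subsetP => y; rewrite !inE => /andP[-> xy]; rewrite andbT.
by apply: contraTneq xy => ->; rewrite iE.
Qed.

Definition common S E x y := [set z in S | E x z && E y z].

Lemma degree_sum_remove_edge S E x y : symmetric E -> irreflexive E -> x \in S -> y \in S ->
  E x y -> (degree_sum (S) E = degree_sum S (remove_edge E x y) + 2)%N.
Proof.
move=> sE iE xS yS exy; rewrite (degree_sum_del sE iE xS).
have sE' : symmetric (remove_edge E x y) by move=> u v; rewrite /remove_edge /= sE setUC.
have iE' : irreflexive (remove_edge E x y) by move=> u; rewrite /remove_edge /= iE.
rewrite (degree_sum_del sE' iE' xS) (@eq_degree_sum _ E (remove_edge E x y)); last first.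
  move=> u v; rewrite !inE => /andP[ux uS] /andP[vx vS]; rewrite /remove_edge /=.
  case: eqP => [uv|]; rewrite ?andbT //; have : x \in [set u; v] by rewrite uv !inE eqxx.
  by rewrite !inE !(eq_sym x) (negbTE ux) (negbTE vx).
rewrite -addnA -(doubleD _ 1); congr (_ + _.*2)%N.
rewrite /degree (cardsD1 y) !inE yS exy addnC; congr addn.
apply: eq_card => z; rewrite !inE /remove_edge /= andbC -andbA; congr andb.
case exz : (E x z) => //=; congr negb; apply/eqP/eqP => [-> //|xz].
have : z \in [set x; y] by rewrite -xz !inE eqxx orbT.
by rewrite !inE => /orP[/eqP zx|/eqP //]; rewrite zx iE in exz.
Qed.

(** Contraction loses the edge [xy] and merges two edges into one at each common neighbour. *)
Lemma degree_sum_contract S E x y : symmetric E -> irreflexive E -> x \in S -> y \in S ->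
  E x y -> (degree_sum S E = degree_sum (S :\ y) (contract E x y) + 2 + #|common S E x y|.*2)%N.
Proof.
move=> sE iE xS yS exy.
have xy : x != y by apply: contraTneq exy => ->; rewrite iE.
have sC : symmetric (contract E x y).
  by move=> u v; rewrite /contract /= (eq_sym u v) (sE u v) (sE u y) (sE v y) [in RHS](orbC (_ && _)).
have iC : irreflexive (contract E x y) by move=> u; rewrite /contract /= eqxx.
have xSy : x \in S :\ y by rewrite !inE xy.
rewrite (degree_sum_del sE iE yS) (degree_sum_del sE iE xSy) (degree_sum_del sC iC xSy).
rewrite (@eq_degree_sum _ (contract E x y) E); last first.
  move=> u v; rewrite !inE => /and3P[ux uy uS] /and3P[vx vy vS]; rewrite /contract /=.
  rewrite (negbTE ux) (negbTE vx) !orbF; case: eqVneq => // ->; by rewrite iE.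
(* Away from [x] and [y] the two relations agree, so only two neighbourhoods matter: their union is
   that of the merged vertex, their intersection is [common], and the 1 is [x] as a neighbour of
   [y]. *)
suff : (degree (S :\ y) E x + degree S E y =
    degree (S :\ y) (contract E x y) x + 1 + #|common S E x y|)%N by lia.
  rewrite /degree (cardsD1 x [set z in S | E y z]) !inE xS sE exy /=.
  have := cardsUI [set z in S :\ y | E x z] ([set z in S | E y z] :\ x).
have -> : [set z in S :\ y | E x z] :|: ([set z in S | E y z] :\ x) =
          [set z in S :\ y | contract E x y x z].
  apply/setP => z; rewrite !inE /contract /= eqxx andTb.
  case: (eqVneq z x) => [->|zx] /=; first by rewrite iE !andbF.
  case: (eqVneq z y) => [->|zy] /=; first by rewrite iE !andbF.
  by rewrite orbF -andb_orr.
have -> : [set z in S :\ y | E x z] :&: ([set z in S | E y z] :\ x) = common S E x y.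
  apply/setP => z; rewrite !inE.
  case: (eqVneq z x) => [->|zx] /=; first by rewrite iE !andbF.
  case: (eqVneq z y) => [->|zy] /=; first by rewrite iE !andbF.
  by case: (z \in S).
lia.
Qed.

(* Mader's extremal argument: a counterexample minimal for vertex deletion,
   edge deletion and contraction has minimum degree 4 or 5, and the
   neighbourhood of a vertex of minimum degree then contains K4 up to one
   contraction. *)
Lemma mader S E : minor S E -> (forall B, ~ K5_model e B) -> (3 <= #|S|)%N ->
  (degree_sum S E + 12 <= 6 * #|S|)%N.
Proof.
move=> + noK5; have [n] := ubnP (#|S| + degree_sum S E).
elim: n S E => // n IH S E; rewrite ltnS => le_n mSE S3.
have [sE iE _] := mSE.
have [S4|S4] := leqP 4 #|S|; last first.
  have {S3 S4} S3 : #|S| = 3 by apply/eqP; rewrite eqn_leq -ltnS S4.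
  have : (degree_sum S E <= \sum_(x in S) 2)%N.
    by apply: leq_sum => x xS; have := degree_lt iE xS; rewrite S3.
  by rewrite sum_nat_const; lia.
have [//|big] := leqP (degree_sum S E + 12) (6 * #|S|).
(* Otherwise deleting [x] loses at most 3 edges while the bound [3n - 6] drops by 3, leaving a
   smaller counterexample. *)
have deg4 x : x \in S -> (4 <= degree S E x)%N.
  move=> xS; have := IH _ _ _ (minor_del x mSE).
  have := degree_sum_del sE iE xS; have := cardsD1 x S; rewrite xS; lia.
(* Minimality under edge deletion leaves exactly [3n - 5] edges, hence a vertex of degree at most
   5. *)
have small : (degree_sum S E + 10 <= 6 * #|S|)%N.
  have [x xS] : exists x, x \in S by apply/set0Pn; rewrite -cards_eq0; lia.
  have [y] : exists y, y \in [set y in S | E x y].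
    by apply/set0Pn; rewrite -cards_eq0; have := deg4 x xS; rewrite /degree; lia.
  rewrite inE => /andP[yS exy].
  have := IH _ _ _ (minor_remove_edge x y mSE) S3.
  have := degree_sum_remove_edge sE iE xS yS exy; lia.
(* The loss under contraction, one more than the number of common neighbours, must exceed 3. *)
have com3 x y : x \in S -> y \in S -> E x y -> (3 <= #|common S E x y|)%N.
  move=> xS yS exy; have := IH _ _ _ (minor_contract mSE xS yS exy).
  have := degree_sum_contract sE iE xS yS exy; have := cardsD1 y S; rewrite yS; lia.
have [x xS deg5] : exists2 x, x \in S & (degree S E x <= 5)%N.
  apply/exists_inP; rewrite -[X in is_true X]negbK negb_exists_in; apply/negP => /forall_inP deg6.
  have : (\sum_(x in S) 6 <= degree_sum S E)%N.
    by apply: leq_sum => x /deg6; rewrite -ltnNge.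
  by rewrite sum_nat_const; lia.
have noclique S' E' s : minor S' E' -> size s = 5 -> {subset s <= S'} -> ~~ pairwise E' s.
  by move=> m s5 sS; apply/negP => /(minor_clique m s5 sS)[B /noK5].
pose N := [set y in S | E x y].
have NE y : y \in N -> (y \in S) /\ E x y by rewrite inE => /andP[].
have NS y : y \in N -> y \in S by move=> /NE[].
have Nx y : y \in N -> E x y by move=> /NE[].
have N4 : (4 <= #|N|)%N by exact: deg4.
have deg3 y : y \in N -> (3 <= #|[set z in N | E y z]|)%N.
  move=> /NE[yS xy]; have := com3 x y xS yS xy; congr (_ <= _)%N.
  by apply: eq_card => z; rewrite !inE andbA.
(* [N] has at most five vertices and [y] has three neighbours there, so [y] misses at most one other
   vertex of [N]. *)
have other y u v : y \in N -> u \in N -> v \in N -> u != v -> u != y -> v != y ->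
    ~~ E y u -> E y v.
  move=> yN uN vN uv uy vy yu; apply: contraLR (deg3 y yN) => yv; rewrite -ltnNge ltnS.
  have : (#|[set z in N | E y z]| <= #|N :\ y :\ u :\ v|)%N.
    apply: subset_leq_card; apply/subsetP => z.
    rewrite [z \in [set _ in N | _]]inE => /andP[zN yz].
    rewrite !in_setD1 zN andbT; apply/and3P.
    by split; apply: contraTneq yz => ->; rewrite ?iE.
  have := cardsD1 y N; have := cardsD1 u (N :\ y); have := cardsD1 v (N :\ y :\ u).
  rewrite !in_setD1 yN uN vN uy vy (eq_sym v) uv /=.
  move: deg5; rewrite -[degree S E x]/(#|N|); lia.
have [cl|] := boolP [forall a in N, forall b in N, (a != b) ==> E a b].
  have {}cl a b : a \in N -> b \in N -> a != b -> E a b.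
    by move=> aN bN; apply/implyP; move/forall_inP/(_ a aN)/forall_inP: cl; exact.
  move: N4; rewrite cardE; have := mem_enum N; have := enum_uniq N.
  case: (enum N) => [|a [|b [|c [|d l]]]] //= uq mN _.
  have [aN bN cN dN] : [/\ a \in N, b \in N, c \in N & d \in N].
    by rewrite -!mN !inE !eqxx !orbT.
  move: uq; rewrite !inE !negb_or -!andbA => /and5P[ab ac ad _ /and4P[bc bd _ /andP[cd _]]].
  exfalso; apply: (negP (noclique S E [:: x; a; b; c; d] mSE erefl _)).
    by move=> z; rewrite 5!inE => /or4P[/eqP->//|/eqP->|/eqP->|/orP[]/eqP->]; apply: NS.
  by rewrite /= !Nx // !cl.
rewrite negb_forall_in => /exists_inP[a aN]; rewrite negb_forall_in => /exists_inP[b bN].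
rewrite negb_imply => /andP[ab nab].
have N5 : #|N :\ a :\ b| = 3.
  have := cardsD1 a N; have := cardsD1 b (N :\ a); rewrite !in_setD1 aN bN (eq_sym b) ab /=.
  have : (#|[set z in N | E a z]| <= #|N :\ a :\ b|)%N.
    apply: subset_leq_card; apply/subsetP => z.
    rewrite [z \in [set _ in N | _]]inE => /andP[zN az].
    rewrite !in_setD1 zN andbT; apply/andP.
    by split; apply: contraTneq az => ->; rewrite ?iE.
  have := deg3 a aN; move: deg5; rewrite -[degree S E x]/(#|N|); lia.
have nba : ~~ E b a by rewrite sE.
have adj p : p \in N :\ a :\ b -> [/\ p \in N, p != a, p != b, E a p & E b p].
  rewrite !in_setD1 => /and3P[pb pa pN]; split => //.
    by apply: (other a b p) => //; rewrite eq_sym.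
  by apply: (other b a p) => //; rewrite eq_sym.
(* If [p] and [q] were non-adjacent, contracting [q] into [b] would create the missing edge [ab]
   through [aq], and [x, a, p, r, b] would be complete. Hence the three vertices form a triangle,
   which together with [x] and [a] is a K5. *)
have tri p q r : p \in N :\ a :\ b -> q \in N :\ a :\ b -> r \in N :\ a :\ b ->
    p != q -> p != r -> q != r -> E p q.
  move=> /adj[pN pa pb ap bp] /adj[qN qa qb aq bq] /adj[rN ra rb ar br] pq pr qr.
  apply/idPn => npq.
  have epr : E p r by apply: (other p q r) => //; rewrite eq_sym.
  have [[pS xp] [qS xq] [rS xr] [aS xa] [bS xb]] :=
    And5 (NE p pN) (NE q qN) (NE r rN) (NE a aN) (NE b bN).
  have xn z : E x z -> x != z by move=> xz; apply: contraTneq xz => <-; rewrite iE.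
  exfalso; apply: (negP (noclique _ _ [:: x; a; p; r; b]
    (minor_contract mSE bS qS bq) erefl _)).
    move=> z; rewrite !inE => /or4P[/eqP->|/eqP->|/eqP->|/orP[]/eqP->].
    - by rewrite xn ?xS.
    - by rewrite eq_sym qa.
    - by rewrite pq.
    - by rewrite eq_sym qr.
    - by rewrite eq_sym qb.
  rewrite /= /contract /= xa xp xr xb ap ar epr aq !eqxx !xn //.
  by rewrite (sE p b) bp (sE r b) br ab pb rb pr (eq_sym a p) pa (eq_sym a r) ra !orbT.
move: N5; rewrite cardE; have := mem_enum (N :\ a :\ b); have := enum_uniq (N :\ a :\ b).
case: (enum _) => [|c [|d [|f [|? ?]]]] //= uq mN _.
have [cN dN fN] : [/\ c \in N :\ a :\ b, d \in N :\ a :\ b & f \in N :\ a :\ b].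
  by rewrite -!mN !inE !eqxx !orbT.
move: uq; rewrite !inE !negb_or -!andbA => /and4P[cd cf df _].
exfalso; apply: (negP (noclique S E [:: x; a; c; d; f] mSE erefl _)).
  have [[cN' _ _ _ _] [dN' _ _ _ _] [fN' _ _ _ _]] := And3 (adj c cN) (adj d dN) (adj f fN).
  by move=> z; rewrite 5!inE => /or4P[/eqP->//|/eqP->|/eqP->|/orP[]/eqP->]; apply: NS.
have [[cN' _ _ ac _] [dN' _ _ ad _] [fN' _ _ af _]] := And3 (adj c cN) (adj d dN) (adj f fN).
rewrite /= ac ad af (tri c d f) // (tri c f d) // 1?(eq_sym f) //
  (tri d f c) // 1?(eq_sym d) // 1?(eq_sym f) //.
by rewrite !Nx.
Qed.
End Mader.

(** * Distance layers and the edge count along them *)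

Section Layers.
Import mathcomp.boot.fintype mathcomp.boot.finset.
Variables (T : finType) (e : rel T) (lv : T -> nat) (u : T) (D : nat).
Hypothesis e_sym : symmetric e.
Hypothesis e_irr : irreflexive e.
Hypothesis no_K5 : forall B, ~ K5_model e B.
Hypothesis lv_eq0 : forall v, (lv v == 0) = (v == u).
Hypothesis lv_edge : forall x y, e x y -> (lv x <= (lv y).+1)%N.
Hypothesis lv_pred : forall v, (0 < lv v)%N -> exists2 w, e v w & lv v = (lv w).+1.
Hypothesis lv_max : forall i, (i <= D)%N -> exists v, lv v = i.

Local Notation L i := [set v | lv v == i].
Local Notation P i := [set v | (lv v <= i)%N].
Local Notation S a b := [set v | (a <= lv v <= b)%N].
(** The strict inequality delays counting a vertex until the layer above it is appended, as in
    [low_step]. *)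
Local Notation low i := [set v | (lv v < i)%N && (degree [set: T] e v <= 2)%N].

Definition complete_layer a : rel T :=
  [rel x y | e x y || [&& lv x == a, lv y == a & x != y]].

Lemma degree_sumE (A : {set T}) (E : rel T) :
  degree_sum A E = (\sum_x \sum_y [&& x \in A, y \in A & E x y])%N.
Proof.
rewrite /degree_sum big_mkcond; apply: eq_bigr => x _.
case: (x \in A); last by rewrite big1.
rewrite /degree -sum1_card big_mkcond; apply: eq_bigr => y _; rewrite inE.
by case: (_ && _).
Qed.

Lemma lv_root : lv u = 0.
Proof. by apply/eqP; rewrite lv_eq0. Qed.

(** Every vertex descends to the root through smaller layers. This set is the branch set that
    absorbs everything below the layer of [y]. *)
Lemma connected_ball y : connected_set e (y |: [set v | (lv v < lv y)%N]).
Proof.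
set A := _ |: _.
have yA v : v \in A -> v = y \/ (lv v < lv y)%N.
  by rewrite !inE => /orP[/eqP|]; [left|right].
have uA v : v \in A -> u \in A.
  move=> vA; rewrite !inE; case: (posnP (lv y)) => [/eqP|y0].
    by rewrite lv_eq0 => /eqP->; rewrite eqxx.
  by rewrite lv_root y0 orbT.
have root v : v \in A -> connect [rel a b | [&& a \in A, b \in A & e a b]] v u.
  have [n] := ubnP (lv v); elim: n v => // n IH v; rewrite ltnS => vn vA.
  case: (posnP (lv v)) => [/eqP|v0]; first by rewrite lv_eq0 => /eqP->.
  have [w vw lvw] := lv_pred v0.
  have wA : w \in A.
    rewrite !inE; case: (yA v vA) => [<-|lt]; rewrite ?lvw ?ltnS ?leqnn ?orbT //.
    by rewrite (ltn_trans _ lt) ?lvw ?orbT.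
  apply: connect_trans (connect1 _) (IH w _ wA); last by rewrite -lvw.
  by rewrite /= vA wA.
move=> a b aA bA; apply: connect_trans (root a aA) _.
rewrite sym_connect_sym ?root // => p q /=; by rewrite e_sym andbCA.
Qed.

Lemma card_L0 : #|L 0| = 1.
Proof. by rewrite (_ : L 0 = [set u]) ?cards1 //; apply/setP => v; rewrite !inE lv_eq0. Qed.

(* Two vertices of one layer become adjacent once all earlier layers are
   contracted into one of them. *)
Lemma minor_slab a b : (a <= D)%N -> (#|L a| <= 2)%N -> minor e (S a b) (complete_layer a).
Proof.
move=> aD La; split.
- by move=> x y; rewrite /complete_layer /= (e_sym x y) (eq_sym x y) andbCA.
- by move=> x; rewrite /complete_layer /= e_irr eqxx !andbF.
have [y0 y0a] := lv_max aD.
have two x y : lv x = a -> lv y = a -> x != y -> x = y0 \/ y = y0.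
  move=> xa ya xy; case: (eqVneq x y0) => [->|xy0]; [by left|right].
  apply/eqP/negPn/negP => yy0; move: La; rewrite leqNgt => /negP; apply.
  apply: (@leq_trans #|[set x; y; y0]|).
    by rewrite setUC cardsU1 cards2 !inE negb_or xy !(eq_sym y0) xy0 yy0.
  apply: subset_leq_card; apply/subsetP => z; rewrite !inE => /orP[/orP[]|] /eqP->; exact/eqP.
exists (fun x => if x == y0 then y0 |: [set v | (lv v < a)%N] else [set x]); split.
- move=> x _; case: ifP => _; split.
  + by apply/set0Pn; exists y0; rewrite !inE eqxx.
  + by rewrite -y0a; exact: connected_ball.
  + by apply/set0Pn; exists x; rewrite inE.
  + by move=> y z; rewrite !inE => /eqP-> /eqP->; exact: connect0.
- have dis x : x \in S a b -> x != y0 -> [disjoint y0 |: [set v | (lv v < a)%N] & [set x]].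
    rewrite inE => /andP[ax _] xy0; rewrite disjoint_sym disjoints1 !inE negb_or xy0 /= -leqNgt.
    exact: ax.
  move=> x y xS yS xy; case: eqVneq => [xy0|xy0]; case: eqVneq => [yy0|yy0].
  + by rewrite xy0 yy0 eqxx in xy.
  + exact: dis.
  + by rewrite disjoint_sym dis.
  + by rewrite disjoints1 inE.
- have inB x : x \in if x == y0 then y0 |: [set v | (lv v < a)%N] else [set x].
    by case: eqVneq => [->|_]; rewrite !inE eqxx.
  have down x : lv x = a -> x != y0 -> exists w, [/\ lv w < a, e x w & (0 < a)%N]%N.
    move=> xa xy0; have a0 : (0 < a)%N.
      rewrite lt0n; apply: contra xy0 => /eqP a0; move: (lv_eq0 x) (lv_eq0 y0).
      by rewrite xa y0a a0 eqxx => /esym/eqP-> /esym/eqP->.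
    have [|w xw lw] := @lv_pred x; first by rewrite xa.
    by exists w; rewrite -xa lw.
  move=> x y xS yS /orP[exy|/and3P[/eqP xa /eqP ya xy]]; first by exists x, y.
  have [xy0|yy0] := two x y xa ya xy.
  + have yy0 : y != y0 by rewrite -xy0 eq_sym.
    have [w [wa yw _]] := down y ya yy0.
    exists w, y; split; rewrite ?inB ?xy0 ?eqxx //; last by rewrite e_sym.
    by rewrite !inE wa orbT.
  + have xy0 : x != y0 by rewrite -yy0.
    have [w [wa xw _]] := down x xa xy0.
    exists x, w; split; rewrite ?inB ?yy0 ?eqxx //.
    by rewrite !inE wa orbT.
Qed.

(** No edge skips a layer, so an edge inside [P b] lies in [P a] or in the slab, and in both exactly
    when it lies in layer [a]. The product on the left pays for completing that layer. *)
Lemma degree_sum_slab a b : (a <= b)%N ->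
  (degree_sum (P b) e + #|L a| * (#|L a|).-1 =
   degree_sum (P a) e + degree_sum (S a b) (complete_layer a))%N.
Proof.
move=> ab.
have -> : (#|L a| * (#|L a|).-1 = degree_sum (L a) [rel x y | x != y])%N.
  rewrite /degree_sum -sum_nat_const; apply: eq_bigr => x xL.
  rewrite (cardsD1 x) xL /=; apply: eq_card => y; rewrite !inE /=.
  by rewrite andbC (eq_sym y x).
rewrite !degree_sumE -!big_split; apply: eq_bigr => x _ /=.
rewrite -!big_split; apply: eq_bigr => y _ /=; rewrite !inE /complete_layer /=.
have := @lv_edge x y; have := @lv_edge y x; rewrite (e_sym y x).
have : e x y -> x != y by apply: contraTneq => ->; rewrite e_irr.
case: (e x y) => /= [/(_ isT)-> /(_ isT) ? /(_ isT) ?|_ _ _]; last by case: (x != y); lia.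
lia.
Qed.

Lemma card_sumE (A : {set T}) : #|A| = (\sum_x (x \in A))%N.
Proof. by rewrite -sum1_card big_mkcond; apply: eq_bigr => x _; case: ifP. Qed.

Lemma card_slab a b : (a <= b)%N -> (#|S a b| + #|P a| = #|P b| + #|L a|)%N.
Proof.
move=> ab; rewrite !card_sumE -!big_split.
apply: eq_bigr => x _ /=; rewrite !inE; lia.
Qed.

Lemma degree_sum_step a b : (a < b <= D)%N -> (#|L a| <= 2)%N ->
  (3 <= #|S a b|)%N ->
  (degree_sum (P b) e + #|L a| * (#|L a|).-1 + 12 <= degree_sum (P a) e + 6 * #|S a b|)%N.
Proof.
move=> /andP[ab bD] La S3; rewrite (degree_sum_slab (ltnW ab)) -addnA leq_add2l.
by apply: (mader e_sym _ no_K5 S3); apply: minor_slab => //; apply: leq_trans bD; exact: ltnW.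
Qed.

Lemma card_PS i : #|P i.+1| = (#|P i| + #|L i.+1|)%N.
Proof.
rewrite !card_sumE -!big_split.
apply: eq_bigr => x _ /=; rewrite !inE; lia.
Qed.

Lemma card_L_gt0 i : (i <= D)%N -> (0 < #|L i|)%N.
Proof. by move=> /lv_max[v vi]; apply/card_gt0P; exists v; rewrite inE vi. Qed.

Lemma card_P_thick a b : (a < b)%N -> (forall i, (a < i < b)%N -> (3 <= #|L i|)%N) ->
  (#|P a| + 3 * (b - a.+1) + #|L b| <= #|P b|)%N.
Proof.
elim: b => // b IH; rewrite ltnS leq_eqVlt => /orP[/eqP->|ab] thick.
  by rewrite subnn card_PS addn0.
have {}IH : (#|P a| + 3 * (b - a.+1) + #|L b| <= #|P b|)%N.
  by apply: IH => // i /andP[ai ib]; apply: thick; rewrite ai ltnW.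
have := thick b; rewrite ab ltnSn card_PS => /(_ isT); lia.
Qed.

Lemma low_mono a b : (a <= b)%N -> (#|low a| <= #|low b|)%N.
Proof.
move=> ab; apply: subset_leq_card; apply/subsetP => v; rewrite !inE => /andP[va ->].
by rewrite andbT (leq_trans va).
Qed.

(** The only vertex of layer [b] has at most one neighbour in the layer above and at most one in the
    layer below, if there is one; it is newly counted. *)
Lemma low_step b : (b < D)%N -> #|L b| = 1 -> #|L b.+1| = 1 ->
  (b = 0 \/ #|L b.-1| = 1) -> (#|low b| < #|low b.+1|)%N.
Proof.
move=> bD Lb Lb1 Lb2; have [v vb] := lv_max (ltnW bD).
apply: proper_card; apply/properP; split.
  by apply/subsetP => w; rewrite !inE => /andP[wb ->]; rewrite andbT ltnW.
exists v; rewrite !inE vb ?ltnn // ltnSn /=.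
have sub : [set y in [set: T] | e v y] \subset
    (if b is b'.+1 then L b' else set0) :|: L b :\ v :|: L b.+1.
  apply/subsetP => y; rewrite !inE /= => vy; have := lv_edge vy; have := @lv_edge y v.
  rewrite e_sym vy vb => /(_ isT) h1 h2.
  have -> : y != v by apply: contraTneq vy => ->; rewrite e_irr.
  by case: (b) h1 h2 => [|b'] h1 h2; rewrite !inE; lia.
apply: leq_trans (subset_leq_card sub) _.
have -> : L b :\ v = set0.
  by apply/eqP; rewrite -cards_eq0; have := cardsD1 v (L b); rewrite inE vb eqxx Lb; lia.
rewrite setU0; apply: leq_trans (leq_card_setU _ _) _; rewrite Lb1 addn1 ltnS.
by case: (b) Lb2 => [|b'] [] //; rewrite ?cards0 // => ->.
Qed.

(* The surplus required of the layers up to b for the next slab to be appended.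
   A second consecutive singleton layer costs one unit (10 becomes 9); a third
   one gains two, thanks to the vertex of degree 2 in the middle. *)
Definition layer_slack b : nat :=
  if #|L b| == 1 then (if (0 < b)%N && (1 < #|L b.-1|)%N then 10 else 9)
  else if #|L b| == 2 then 13 else 1.

Lemma layer_invariant b : (b <= D)%N ->
  (degree_sum (P b) e + 8 * b + layer_slack b <= 9 * #|P b| + 3 * #|low b|)%N.
Proof.
have [n] := ubnP b; elim: n b => // n IH [|b].
  move=> _ _; rewrite /layer_slack card_L0 /= (_ : #|P 0| = 1); last first.
    by rewrite -card_L0; apply: eq_card => v; rewrite !inE leqn0.
  rewrite addn0; suff -> : degree_sum (P 0) e = 0%N by [].
  have P0 v : v \in P 0 -> v = u by rewrite inE leqn0 lv_eq0 => /eqP.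
  rewrite /degree_sum big1 // => x /P0->; apply/eqP; rewrite cards_eq0 -subset0.
  by apply/subsetP => y; rewrite inE => /andP[/P0->]; rewrite e_irr.
rewrite ltnS => bn bD.
(* [a] is the last layer before [b.+1] with at most two vertices; it exists because layer 0 is a
   singleton. *)
have [a /andP[ab La] amax] : exists2 a, (a < b.+1)%N && (#|L a| <= 2)%N &
    forall i, (a < i < b.+1)%N -> (3 <= #|L i|)%N.
  have ex : exists a, (a < b.+1)%N && (#|L a| <= 2)%N by exists 0; rewrite card_L0.
  have ub i : (i < b.+1)%N && (#|L i| <= 2)%N -> (i <= b)%N by move=> /andP[].
  case: (ex_maxnP ex ub) => a aP amax; exists a => // i /andP[ai ib].
  by rewrite ltnNge; apply/negP => i2; have := amax i; rewrite ib i2 leqNgt ai => /(_ isT).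
have aD : (a <= D)%N by apply: leq_trans bD; rewrite ltnW.
have := IH a (leq_trans ab bn) aD.
have := card_P_thick ab amax; have := card_slab (ltnW ab).
have La0 := card_L_gt0 aD; have Lb0 := card_L_gt0 bD; have := low_mono (ltnW ab).
(* Two consecutive singletons form a slab of two vertices, too small for Mader's bound; its degree
   sum is at most 2. *)
have [/and3P[/eqP ba /eqP La1 /eqP Lb1]|nthin] :=
  boolP [&& a == b, #|L a| == 1 & #|L b.+1| == 1].
  rewrite -{b}ba in bD Lb1 {Lb0 ab amax bn} *; rewrite /layer_slack La1 Lb1 eqxx /=.
  have := degree_sum_slab (leqnSn a); rewrite La1.
  have : (degree_sum (S a a.+1) (complete_layer a) <= \sum_(x in S a a.+1) (#|S a a.+1|).-1)%N.
    apply: leq_sum => x xS; rewrite -ltnS prednK; last by apply/card_gt0P; exists x.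
    by apply: degree_lt xS => y; rewrite /complete_layer /= e_irr eqxx !andbF.
  rewrite sum_nat_const card_PS Lb1 => + + low_le Seq.
  have -> : #|S a a.+1| = 2 by lia.
  have := low_step bD La1 Lb1.
  case: posnP => [a0 /(_ (or_introl a0))|a0] /=; first by lia.
  have La2 : (0 < #|L a.-1|)%N by apply: card_L_gt0; rewrite (leq_trans (leq_pred a)).
  have {La2} [La2|La2] : (1 < #|L a.-1|)%N \/ #|L a.-1| = 1 by lia.
    by rewrite La2; lia.
  by rewrite La2 => /(_ (or_intror erefl)) /=; lia.
move=> low_le Seq Pge; have S3 : (3 <= #|S a b.+1|)%N.
  move: nthin; rewrite !negb_and; lia.
have := degree_sum_step (a := a) (b := b.+1); rewrite ab bD => /(_ isT La S3).
(* With [g = b.+1 - a] and [m = #|L b.+1|], a slack of 9 at a singleton layer [a] or 13 at a pair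
   makes it enough that the new slack is at most [g + 6 + 3 * m]. This is tight at [g = 1], [m = 2],
   and at [g = 1], [m = 1] after a pair. *)
have : #|L a| = 1 \/ #|L a| = 2 by lia.
have [Lb1|Lb1] := eqVneq #|L b.+1| 1; last first.
  have [Lb2|Lb2] := eqVneq #|L b.+1| 2.
    by case=> La1; rewrite /layer_slack La1 Lb2 /=; do ?case: ifP => _; lia.
  by case=> La1; rewrite /layer_slack La1 (negbTE Lb1) (negbTE Lb2) /=; do ?case: ifP => _; lia.
case=> La1; rewrite /layer_slack La1 Lb1 /=; do ?case: ifP => _; lia.
Qed.

End Layers.

(** * Graph distance and shortest paths *)

Lemma bigminn_le (I : eqType) (r : seq I) (P : pred I) (F : I -> nat) n i :
  i \in r -> P i -> (\big[minn/n]_(j <- r | P j) F j <= F i)%N.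
Proof.
elim: r => // j r IH; rewrite inE big_cons => /orP[/eqP<- ->|ir Pi]; first exact: geq_minl.
by case: ifP => _; rewrite ?geq_min IH ?orbT.
Qed.

Section Distance.
Variable G : sgraph.
Implicit Types u v x y : G.

Lemma dist_le u p : path (@edge G) u p -> (dist u (last u p) <= size p)%N.
Proof.
case/shortenP => q pq uq qp; have /= /andP[_ uq'] := uq.
apply: leq_trans (uniq_leq_size uq' qp).
have qG : (size q < #|G|)%N.
  by have := max_card (mem (u :: q)); rewrite (card_uniqP uq).
apply: (@bigminn_le _ _ _ (fun k : 'I_#|G| => k : nat) _ (Ordinal qG)).
  by rewrite mem_index_enum.
by apply/existsP; exists (in_tuple q); rewrite /is_upath pq eqxx.
Qed.

Lemma dist_path u v : connect (@edge G) u v ->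
  exists p, [/\ path (@edge G) u p, last u p = v & size p = dist u v].
Proof.
move=> /connectP[q pq vq].
have : dist u v = #|G| \/ exists p, [/\ path (@edge G) u p, last u p = v & size p = dist u v].
  rewrite /dist; elim/big_ind: _ => [|m n Pm Pn|k /existsP[p /and3P[pp /eqP lp _]]].
  - by left.
  - by rewrite /minn; case: ifP.
  - by right; exists p; rewrite size_tuple.
(* The default value [#|G|] is excluded: a path without repeated vertices has fewer edges than
   that. *)
case=> // dG; move: pq vq; case/shortenP => r pr ur _ vr.
have := dist_le pr; rewrite -vr dG.
have := max_card (mem (u :: r)); rewrite (card_uniqP ur) /=; lia.
Qed.

Lemma dist_eq0 u v : connect (@edge G) u v -> (dist u v == 0) = (v == u).
Proof.
move=> cuv; apply/eqP/eqP => [d0|->]; last first.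
  by apply/eqP; rewrite -leqn0; exact: (@dist_le u [::]).
by have := dist_path cuv; rewrite d0 => -[[|? ?] [_ <-]].
Qed.

Lemma dist_edge u x y : connect (@edge G) u y -> edge x y -> (dist u x <= (dist u y).+1)%N.
Proof.
move=> /dist_path[p [pp lp <-]] exy.
have := @dist_le u (rcons p x); rewrite rcons_path pp lp edge_sym exy last_rcons size_rcons.
exact.
Qed.

Lemma dist_pred u v : connect (@edge G) u v -> (0 < dist u v)%N ->
  exists2 w, edge v w & dist u v = (dist u w).+1.
Proof.
move=> cuv; have [p [pp lp sp]] := dist_path cuv; rewrite -sp.
elim/last_ind: p pp lp sp => // p z _; rewrite rcons_path last_rcons size_rcons.
move=> /andP[pp ez] zv sp _; subst z; exists (last u p); first by rewrite edge_sym.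
have := dist_le pp; have := @dist_edge u v (last u p); rewrite edge_sym ez -sp.
have cl : connect (@edge G) u (last u p) by apply/connectP; exists p.
by move=> /(_ cl isT); lia.
Qed.

End Distance.

(** * The upper bound on the diameter *)

(** For [d >= 3] this amounts to [(d - 4) * (d - 5) >= 0], an equality at 4 and 5; the bonus 3 makes
    [d = 2] an equality as well. *)
Lemma inv_degree_tangent (R : realType) (d : nat) : (0 < d)%N ->
  9%:R - d%:R + 3%:R * (d <= 2)%N%:R <= 20%:R * (d%:R)^-1 :> R.
Proof.
move=> d0; rewrite ler_pdivlMr ?ltr0n //.
case: d d0 => [|[|[|d]]] // _; rewrite ?leqnn ?ltnS /=.
- by rewrite -!natrM; lra.
- lra.
- rewrite mulr0 addr0 -[d.+3]addn3 natrD.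
  case: d => [|[|d]]; [lra|lra|].
  have := ler0n R d; rewrite -[d.+2]addn2 natrD; nra.
Qed.

Lemma diameter_lt_inverse_degree (R : realType) (G : sgraph) : connected_graph G ->
  (forall B, ~ K5_model (@edge G) B) -> (1 < #|G|)%N ->
  (diameter G)%:R < 5%:R / 2%:R * inverse_degree R G.
Proof.
move=> [G0 cG] noK5 G1.
have [u Du] := bigop.eq_bigmax (fun u : G => \max_v dist u v)%N G0.
have [v Dv] := bigop.eq_bigmax (dist u) G0.
have {}Dv : dist u v = diameter G by rewrite /diameter Du Dv.
have Dmax w : (dist u w <= diameter G)%N.
  by rewrite /diameter Du; exact: bigop.leq_bigmax.
(* Descending from [v] by [dist_pred] meets every smaller distance. *)
have layers i : (i <= diameter G)%N -> exists w, dist u w = i.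
  rewrite -Dv; elim/ltn_ind: (dist u v) {-2}v (erefl (dist u v)) => n IH w wn.
  rewrite leq_eqVlt => /orP[/eqP->|lt]; first by exists w.
  have [|w' _ ww'] := dist_pred (cG u w); first exact: leq_ltn_trans lt.
  by apply: (IH (dist u w')) (erefl _) _; rewrite -ltnS -ww' // wn.
have := layer_invariant (@edge_sym G) (@edge_irr G) noK5 (fun w => dist_eq0 (cG u w))
  (fun x y => @dist_edge G u x y (cG u y)) (fun w => dist_pred (cG u w)) layers (leqnn _).
have PT : finset (fun w => (dist u w <= diameter G)%N) = finset.setT.
  by apply/setP => w; rewrite !inE Dmax.
rewrite PT finset.cardsT => inv.
(* The tangent bound fails at degree 0, whose inverse is 0 by convention; connectedness and a second
   vertex exclude it. *)
have deg_gt0 (w : G) : (0 < deg w)%N.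
  have [w' w'w] : exists w', w' != w.
    have /card_gt1P[x [y [_ _ xy]]] := G1.
    by case: (eqVneq x w) xy => [-> xy|xw _]; [exists y; rewrite eq_sym|exists x].
  have /connectP[[|w2 p] /=] := cG w w'; first by move=> _ /eqP; rewrite (negbTE w'w).
  by move=> /andP[ww2 _] _; apply/card_gt0P; exists w2; rewrite inE.
(* This positive slack makes the final inequality strict. *)
have slack : (0 < layer_slack (dist u) (diameter G))%N.
  by rewrite /layer_slack; do ?case: ifP.
have degE (w : G) : degree finset.setT (@edge G) w = deg w.
  by apply: eq_card => x; rewrite !inE.
have sumE : degree_sum finset.setT (@edge G) = (\sum_(w : G) deg w)%N.
  by apply: eq_big => [w|w _]; [rewrite inE|exact: degE].
have lowE : (#|finset (fun v => (dist u v < diameter G)%N &&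
    (degree finset.setT (@edge G) v <= 2)%N)|
    <= \sum_(w : G) (deg w <= 2))%N.
  rewrite -sum1_card big_mkcond; apply: leq_sum => w _; rewrite inE degE.
  by case: (dist u w < _)%N; case: (deg w <= 2)%N.
have nat_le : ((\sum_(w : G) deg w) + 8 * diameter G <
    9 * #|G| + 3 * \sum_(w : G) (deg w <= 2))%N.
  by move: inv slack lowE; rewrite sumE; lia.
have : (9 * #|G| + 3 * \sum_(w : G) (deg w <= 2))%N%:R - (\sum_(w : G) deg w)%N%:R
    <= 20%:R * inverse_degree R G.
  rewrite natrD !natrM !natr_sum mulr_sumr.
  rewrite (_ : _ - _ = \sum_(w : G) (9%:R - (deg w)%:R + 3%:R * (deg w <= 2)%N%:R)).
    by rewrite /inverse_degree mulr_sumr; apply: ler_sum => w _; exact: inv_degree_tangent.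
  by rewrite !big_split /= sumr_const sumrN -mulr_natr; ring.
have : ((\sum_(w : G) deg w) + 8 * diameter G)%N%:R <
    (9 * #|G| + 3 * \sum_(w : G) (deg w <= 2))%N%:R :> R by rewrite ltr_nat.
rewrite natrD natrM; lra.
Qed.

(** * The extremal family: degrees and diameter *)

Section Ladder.
Variable n : nat.

Definition ladder_edge : rel ('I_n.+1 * bool) :=
  [rel x y : 'I_n.+1 * bool | [&& x != y, (x.1 <= y.1.+1)%N & (y.1 <= x.1.+1)%N]].

Lemma ladder_sym : symmetric ladder_edge.
Proof. by move=> x y; rewrite /ladder_edge /= (eq_sym x y) (andbC (x.1 <= _)%N). Qed.

Lemma ladder_irr : irreflexive ladder_edge.
Proof. by move=> x; rewrite /ladder_edge /= eqxx. Qed.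

Definition ladder : sgraph := SGraph ladder_sym ladder_irr.

Lemma ladder_connected : connected_graph ladder.
Proof.
split; first by apply/card_gt0P; exists (ord0, false).
have root (x : ladder) : connect (@edge ladder) x (ord0, false).
  case: x => -[i ilt] b; elim: i ilt b => [|i IH] ilt b.
    have -> : Ordinal ilt = ord0 by apply: val_inj.
    by case: b; [apply: connect1|exact: connect0].
  have ilt' := ltnW ilt; apply: connect_trans (IH ilt' false); apply: connect1.
  rewrite /edge /= /ladder_edge /= xpair_eqE -val_eqE /=; lia.
move=> x y; apply: connect_trans (root x) _.
by rewrite sym_connect_sym; [exact: root|exact: ladder_sym].
Qed.

(** An edge changes the level by at most one, so any path between the end levels has at least [n]
    edges. *)
Lemma ladder_diameter : (n <= diameter ladder)%N.
Proof.
pose u : ladder := (ord0, false); pose v : ladder := (ord_max, false).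
have step (x : ladder) p : path (@edge ladder) x p -> ((last x p).1 <= x.1 + size p)%N.
  elim: p x => [|y p IH] x /=; first by rewrite addn0.
  move=> /andP[/and3P[_ _ yx] /IH le_last]; apply: leq_trans le_last _.
  by rewrite addnS -addSn leq_add2r.
have [p [pp lp sp]] := dist_path (ladder_connected.2 u v).
apply: (@leq_trans (dist u v)).
  by have := step u p pp; rewrite lp sp.
apply: leq_trans (bigop.leq_bigmax u); exact: (@bigop.leq_bigmax _ (dist u) v).
Qed.

Lemma ladder_deg (x : ladder) : (0 < x.1 < n)%N -> (5 <= deg x)%N.
Proof.
case: x => i b /= /andP[i0 lt_in].
have hp : (i.-1 < n.+1)%N by lia.
have hs : (i.+1 < n.+1)%N by lia.
pose s : seq ladder := [:: (i, ~~ b); (Ordinal hp, false); (Ordinal hp, true);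
  (Ordinal hs, false); (Ordinal hs, true)].
have us : uniq s.
  rewrite /= !inE !xpair_eqE -!val_eqE /= !andbT !andbF !orbF.
  lia.
rewrite (_ : 5 = size s)%N // -(card_uniqP us); apply: subset_leq_card.
apply/fintype.subsetP => y.
rewrite !inE /edge /= /ladder_edge /=.
move=> /or4P[/eqP->|/eqP->|/eqP->|/orP[]/eqP->] /=; rewrite xpair_eqE -val_eqE /=; try lia.
Qed.

Lemma ladder_inverse_degree (R : realType) :
  inverse_degree R ladder <= 2%:R * n.+1%:R / 5%:R + 4%:R.
Proof.
(* Vertices of the end levels are charged an extra 1 per end, which adds up to the constant 4. *)
pose f (i : 'I_n.+1) : R := 5%:R^-1 + (i == ord0)%:R + (i == ord_max)%:R.
have le_f (x : ladder) : (deg x)%:R^-1 <= f x.1.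
  have inv_le1 : ((deg x)%:R^-1 : R) <= 1.
    case: (deg x) => [|d]; first by rewrite invr0 ler01.
    by rewrite invf_le1 ?ltr0n // ler1n.
  rewrite /f; case: eqVneq => [_|x0]; first by case: eqVneq => _ /=; lra.
  case: eqVneq => [_|xn] /=; first by lra.
  rewrite !addr0 lef_pV2 ?posrE ?ltr0n //; last first.
    by apply: leq_trans (ladder_deg _) => //; rewrite lt0n x0 ltn_neqAle xn -ltnS ltn_ord.
  rewrite ler_nat ladder_deg // lt0n x0 ltn_neqAle xn -ltnS ltn_ord //.
rewrite /inverse_degree; apply: le_trans (ler_sum _ (fun x _ => le_f x)) _.
rewrite -(pair_bigA _ (fun i (_ : bool) => f i)) /=.
under eq_bigr do rewrite sumr_const card_bool.
rewrite sumrMnl /f !big_split /= sumr_const card_ord.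
have d1 (j : 'I_n.+1) : \sum_(i < n.+1) ((i == j)%:R : R) = 1.
  by rewrite (bigD1 j) //= eqxx big1 ?addr0 // => i /negbTE->.
rewrite !d1 mulr2n -(mulr_natr _ n.+1); lra.
Qed.
End Ladder.

(** * The two-page drawing of the ladders *)

Section LadderDrawing.
Import numFieldNormedType.Exports.
Local Open Scope classical_set_scope.
Local Open Scope ring_scope.
Variables (R : realType) (n : nat).
Local Notation ladder := (ladder n).
Implicit Types x y z w : ladder.

(** The shift by one keeps the two vertices of level 0 apart. *)
Definition ladder_pos x : int := if x.2 then (x.1 : nat).+1%:Z else - (x.1 : nat).+1%:Z.

(** Edges between the two sides have position sum -1, 0 or 1. Those with sum -1 go below the line,
    since their intervals may interleave with those of sum 1, as [[-2, 1]] and [[-1, 2]] do. *)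
Definition downward x y : bool := (x.2 != y.2) && (ladder_pos x + ladder_pos y < 0).

(** In terms of the abscissa [X], this is the graph of [(X - p) * (q - X)]. *)
Definition parabola (p q t : R) : R * R :=
  (p + (q - p) * t, (q - p) ^+ 2 * (t * (1 - t))).

Definition ladder_pt x : R * R := ((ladder_pos x)%:~R, 0).

Definition ladder_arc x y (t : R) : R * R :=
  let c := parabola (ladder_pos x)%:~R (ladder_pos y)%:~R t in
  (c.1, (-1) ^+ downward x y * c.2).

Lemma ladder_pos_inj : injective ladder_pos.
Proof.
move=> [i a] [j b]; rewrite /ladder_pos /= => h; apply/eqP; rewrite xpair_eqE -val_eqE /=.
by case: a b h => [] [] h; lia.
Qed.

Definition ladder_lo x y : int :=
  if ladder_pos x <= ladder_pos y then ladder_pos x else ladder_pos y.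
Definition ladder_hi x y : int :=
  if ladder_pos x <= ladder_pos y then ladder_pos y else ladder_pos x.

(** On each page the edges between the two sides span a chain of nested intervals; all other edges
    join consecutive integers. *)
Lemma edge_laminar x y z w : edge x y -> edge z w -> downward x y = downward z w ->
  ladder_lo x y < ladder_hi z w -> ladder_lo z w < ladder_hi x y ->
  (ladder_lo x y <= ladder_lo z w) && (ladder_hi z w <= ladder_hi x y) ||
  (ladder_lo z w <= ladder_lo x y) && (ladder_hi x y <= ladder_hi z w).
Proof.
case: x y z w => [i a] [j b] [k c] [l d].
rewrite /edge /= /ladder_edge /= => /and3P[_ ij ji] /and3P[_ kl lk].
rewrite /downward /ladder_lo /ladder_hi /ladder_pos /=.
by case: a b c d => [] [] [] [] /=; do ?case: ifP; lia.
Qed.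

Lemma edge_lo_hi x y z w : ladder_lo x y = ladder_lo z w -> ladder_hi x y = ladder_hi z w ->
  [set x; y]%SET = [set z; w]%SET.
Proof.
move=> h1 h2.
have [[px py]|[px py]] : (ladder_pos x = ladder_pos z /\ ladder_pos y = ladder_pos w) \/
    (ladder_pos x = ladder_pos w /\ ladder_pos y = ladder_pos z).
  by move: h1 h2; rewrite /ladder_lo /ladder_hi; case: ifP; case: ifP; lia.
- by rewrite (ladder_pos_inj px) (ladder_pos_inj py).
- by rewrite (ladder_pos_inj px) (ladder_pos_inj py) finset.setUC.
Qed.

(** Shrinking the interval can only decrease the two positive factors, so equal heights force equal
    ends. *)
Lemma parabola_nested (p q p' q' a : R) : p <= p' -> q' <= q -> p' < a -> a < q' ->
  (a - p) * (q - a) = (a - p') * (q' - a) -> p = p' /\ q = q'.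
Proof. by move=> *; split; nra. Qed.

Lemma arc_parabola x y t : edge x y -> t \in `]0, 1[ ->
  let P := ladder_arc x y t in
  [/\ (ladder_lo x y)%:~R < P.1, P.1 < (ladder_hi x y)%:~R &
      P.2 = (-1) ^+ downward x y *
        ((P.1 - (ladder_lo x y)%:~R) * ((ladder_hi x y)%:~R - P.1))].
Proof.
move=> exy; rewrite in_itv /= => /andP[t0 t1].
have nxy : ladder_pos x != ladder_pos y.
  by apply: contraTneq exy => /ladder_pos_inj->; rewrite edge_irr.
rewrite /ladder_lo /ladder_hi /ladder_arc /parabola /=; case: ifP => h.
  have : (ladder_pos x)%:~R < (ladder_pos y)%:~R :> R by rewrite ltr_int; lia.
  by move=> ?; split; [nra|nra|congr (_ * _); ring].
have : (ladder_pos y)%:~R < (ladder_pos x)%:~R :> R by rewrite ltr_int; lia.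
by move=> ?; split; [nra|nra|congr (_ * _); ring].
Qed.

Lemma ladder_planar : planar R ladder.
Proof.
exists ladder_pt, ladder_arc; split.
- by move=> x y [] /intr_inj /ladder_pos_inj.
- move=> x y _; apply: continuous_subspaceT => t.
  have id_t : s @[s --> t] --> t by exact: cvg_id.
  have h1 : (ladder_arc x y s).1 @[s --> t] --> (ladder_arc x y t).1.
    by apply: cvgD; [exact: cvg_cst|apply: cvgM; [exact: cvg_cst|exact: id_t]].
  have h2 : (ladder_arc x y s).2 @[s --> t] --> (ladder_arc x y t).2.
    apply: cvgM; first exact: cvg_cst.
    apply: cvgM; first exact: cvg_cst.
    by apply: cvgM; [exact: id_t|apply: cvgB; [exact: cvg_cst|exact: id_t]].
  exact: (cvg_pair h1 h2).
- move=> x y exy s t _ _ [] /addrI h _; apply: (mulfI _ h).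
  rewrite subr_eq0 eqr_int; apply: contraTneq exy => /ladder_pos_inj->.
  by rewrite edge_irr.
- by move=> x y _; rewrite /ladder_arc /parabola /= mulr0 addr0 mul0r !mulr0.
- move=> x y _; rewrite /ladder_arc /parabola /= subrr !mulr0 mulr1.
  by rewrite addrC subrK.
- move=> x y _ t _; rewrite /ladder_arc /parabola /=.
  have -> : downward y x = downward x y by rewrite /downward eq_sym addrC.
  by congr (_, _ * _); ring.
- move=> x y z exy t t01; have [h1 h2 h3] := arc_parabola exy t01 => h.
  move: h3; rewrite [X in X.2 = _]h => /esym/eqP; rewrite mulf_eq0 signr_eq0 mulf_eq0 !subr_eq0.
  by rewrite (gt_eqF h1) (gt_eqF h2).
- move=> x y z w exy ezw ne s t s01 t01 eP; apply: ne.
  have [h1 h2 h3] := arc_parabola exy s01; have [h1' h2' h3'] := arc_parabola ezw t01.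
  move: h1' h2' h3'; rewrite -eP => h1' h2' h3'.
  move: (ladder_arc x y s).1 (ladder_arc x y s).2 h1 h2 h3 h1' h2' h3'.
  move=> a b h1 h2 h3 h1' h2' h3'.
  have l1 : ladder_lo x y < ladder_hi z w by rewrite -(ltr_int R); exact: lt_trans h1 h2'.
  have l2 : ladder_lo z w < ladder_hi x y by rewrite -(ltr_int R); exact: lt_trans h1' h2.
  (* Inner points of an arc have nonzero height with the sign of its page, so a common point
     determines the page. *)
  have dd : downward x y = downward z w.
    move: h3; rewrite h3'; case: downward; case: downward => //=; nra.
  move: h3; rewrite h3' dd => /(mulfI (negbT (signr_eq0 _ _))) h.
  have := edge_laminar exy ezw dd l1 l2.
  rewrite -!(ler_int R).
  move=> /orP[] /andP[n1 n2].
    have [e1 e2] := parabola_nested n1 n2 h1' h2' (esym h).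
    by apply: edge_lo_hi; apply: (intr_inj (R := R)).
  have [e1 e2] := parabola_nested n1 n2 h1 h2 h.
  by apply: edge_lo_hi; apply: (intr_inj (R := R)).
Qed.

End LadderDrawing.

Lemma ladder_not_isomorphic m n : m <> n -> ~ isomorphic (ladder m) (ladder n).
Proof.
move=> mn [f /bij_eq_card]; rewrite !card_prod !card_ord card_bool => /eqP.
by rewrite eqn_mul2r /= eqSS => /eqP.
Qed.

Theorem theorem1 (R : realType) :
  (forall G : sgraph, connected_graph G -> planar R G -> (1 < #|G|)%N ->
     (diameter G)%:R < 5%:R / 2%:R * inverse_degree R G)
  /\
  (exists (C : R) (G : nat -> sgraph),
     (forall m n : nat, m <> n -> ~ isomorphic (G m) (G n)) /\
     (forall n : nat,
        [/\ connected_graph (G n),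
            planar R (G n) &
            5%:R / 2%:R * inverse_degree R (G n) - C
              <= (diameter (G n))%:R])).
Proof.
split=> [G cG [pt [arc dr]]|].
  by apply: diameter_lt_inverse_degree => // B; exact: plane_drawing_no_K5 dr B.
(* The constant comes from [5/2 * (2 * (n + 1) / 5 + 4) = n + 11]. *)
exists 11%:R, ladder; split=> [m n|n]; first exact: ladder_not_isomorphic.
split; [exact: ladder_connected|exact: ladder_planar|].
have := ladder_inverse_degree n R; have : n%:R <= (diameter (ladder n))%:R :> R.
  by rewrite ler_nat ladder_diameter.
rewrite -[n.+1]addn1 natrD; lra.
Qed.
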